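(* Let $L_{\mathcal{F}}$ and $L_{\mathcal{R}}$ be Lipschitz constants of $\mathcal{F}$ and $\mathcal{R}$ over $\Omega_\theta$, and suppose $\beta>L_{\mathcal{F}}+L_{\mathcal{R}}$. If $\bar z\in\mathcal{Z}$ with $\mathcal{O}(\bar z)<\theta$ is a generalized KKT point of problem (LRP), then $\bar z\in\Omega_1$ and $\bar z$ is a generalized d-stationary point of (LRP). In addition, if $\bar z\in\mathrm{int}(\Omega_3)$, then $\bar z$ is a generalized d-stationary point of (RP). Furthermore, if (in addition) $\mathcal{P}$ is regular at $\bar z$, then $\bar z$ is a generalized d-stationary point of (R).
   Context: Let $N,N_0,N_1$ be positive integers, $X=(x_1,\ldots,x_N)\in\mathbb{R}^{N_0\times N}$ a given data matrix, and $\lambda_1,\lambda_2,\beta>0$ given parameters. For a real vector $y$, $(y)_+=\max\{y,0\}$ componentwise; $e$ denotes the all-ones vector of $\mathbb{R}^{N_1}$ and $e_m$ the all-ones vector of $\mathbb{R}^m$. For a matrix $Y$, $\|Y\|_F$ is the Frobenius norm and $\|Y\|_1$ the maximum absolute column sum. The variable is $z=(\mathrm{vec}(W)^\top,b^\top,\mathrm{vec}(V)^\top)^\top\in\mathbb{R}^{N_2}$, $N_2=N_0N_1+N_1+N_0+N_1N$, where $W\in\mathbb{R}^{N_1\times N_0}$, $b=(b_1^\top,b_2^\top)^\top$ with $b_1\in\mathbb{R}^{N_1}$, $b_2\in\mathbb{R}^{N_0}$, $V=(v_1,\ldots,v_N)\in\mathbb{R}^{N_1\times N}$, and vec is columnwise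 vectorization. Define $\mathcal{F}(z)=\frac1N\sum_{n=1}^N\|(W^\top v_n+b_2)_+-x_n\|_2^2$, $\mathcal{R}(z)=\lambda_1\sum_{n=1}^N e^\top v_n+\lambda_2\|W\|_F^2$, $\mathcal{P}(z)=\beta\sum_{n=1}^N e^\top(v_n-(Wx_n+b_1)_+)$, and $\mathcal{O}=\mathcal{F}+\mathcal{R}+\mathcal{P}$. Let $\Omega_1=\{z: v_n=(Wx_n+b_1)_+,\ n=1,\ldots,N\}$, $\Omega_2=\{z: v_n\ge (Wx_n+b_1)_+,\ n=1,\ldots,N\}$. Fix $\theta>\frac1N\|X\|_F^2$ and set $\alpha=\max\left\{\frac{\theta}{\lambda_1}+\sqrt{\frac{N_1N_0\theta}{\lambda_2}}\|X\|_1,\ \frac{\theta\sqrt{N_1N_0\theta}}{\lambda_1\sqrt{\lambda_2}}+\sqrt{N\theta}+\|X\|_1\right\}$. Let $\Omega_3=\{z:\|b\|_\infty\le\alpha\}$, $\mathcal{Z}=\Omega_2\cap\Omega_3$, $\Omega_\theta=\{z\in\Omega_2:\mathcal{O}(z)\le\theta\}$. Write $\mathcal{Z}=\{z: Az\le c\}$ with $\nu=2(NN_1+N_0+N_1)$, where $A\in\mathbb{R}^{\nu\times N_2}$, $c\in\mathbb{R}^\nu$ are defined by $Az-c=\big(\mathrm{vec}(WX+b_1e_N^\top-V);\ -\mathrm{vec}(V);\ b-\alpha e_{N_1+N_0};\ -b-\alpha e_{N_1+N_0}\big)$. Problem (R): minimize $\mathcal{F}(z)+\mathcal{R}(z)$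 over $\Omega_1$; (RP): minimize $\mathcal{O}(z)$ over $\Omega_2$; (LRP): minimize $\mathcal{O}(z)$ over $\mathcal{Z}$. For locally Lipschitz $f$: the Clarke subdifferential is $\partial f(y^* )=\mathrm{co}\{\lim_{y\to y^*}\nabla f(y): f \text{ smooth at } y\}$; the generalized directional derivative is $f^\circ(\bar y;d)=\limsup_{y\to\bar y,t\downarrow0}(f(y+td)-f(y))/t$; $f'(\bar y;d)=\lim_{t\downarrow0}(f(\bar y+td)-f(\bar y))/t$; $f$ is regular at $\bar y$ if $f'(\bar y;d)$ exists and equals $f^\circ(\bar y;d)$ for all $d$. For a set $\Omega$ and $\bar y\in\Omega$, $\mathcal{T}_\Omega(\bar y)=\{d: d=\lim (y-\bar y)/\tau,\ y\in\Omega,\ y\to\bar y,\ \tau\downarrow0\}$. A point $\bar z\in\Omega_1$ is a generalized d-stationary point of (R) if $\mathcal{F}^\circ(\bar z;d)+\nabla\mathcal{R}(\bar z)^\top d\ge0$ for all $d\in\mathcal{T}_{\Omega_1}(\bar z)$; $\bar z\in\Omega_2$ (resp. $\bar z\in\mathcal{Z}$) is a generalized d-stationary point of (RP) (resp. (LRP)) if $\mathcal{O}^\circ(\bar z;d)\ge0$ for all $d\in\mathcal{T}_{\Omega_2}(\bar z)$ (resp. $d\in\mathcal{T}_{\mathcal{Z}}(\bar z)$). A point $\bar z\in\mathcal{Z}$ is a generalized KKT point of (LRP) if there is $\bar\gamma\in\mathbb{R}^\nu$, $\bar\gamma\ge0$, with $0\in\partial\mathcal{O}(\bar z)+A^\top\bar\gamma$,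 $\bar\gamma^\top(A\bar z-c)=0$, $A\bar z-c\le0$. *)

(* Defs.v *)
From HB Require Import structures.
From mathcomp Require Import all_boot all_order all_algebra.
From mathcomp Require Import all_classical all_reals.
From mathcomp Require Import ereal topology normedtype sequences.
Set Implicit Arguments. Unset Strict Implicit. Unset Printing Implicit Defensive.
Import Order.TTheory GRing.Theory Num.Theory.
Import numFieldNormedType.Exports.
Local Open Scope classical_set_scope.
Local Open Scope ring_scope.

Section Generic.
Variables (R : realType) (n : nat).
Implicit Types (x y g d : 'cV[R]_n) (f : 'cV[R]_n -> R).

Definition vdot x y : R := \sum_(i < n) x i 0 * y i 0.
Definition enorm x : R := Num.sqrt (vdot x x).

Definition is_gradient f y g : Prop :=
  forall e : R, 0 < e -> exists2 del : R, 0 < del &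
    forall h, enorm h < del -> `|f (y + h) - f y - vdot g h| <= e * enorm h.

Definition differentiable_at f y : Prop := exists g, is_gradient f y g.

Definition limiting_gradients f ystar : set 'cV[R]_n :=
  [set g | exists (y : nat -> 'cV[R]_n) (gs : nat -> 'cV[R]_n),
     (forall k, is_gradient f (y k) (gs k)) /\
     (fun k => enorm (y k - ystar)) @ \oo --> (0 : R) /\
     (fun k => enorm (gs k - g)) @ \oo --> (0 : R)].

Definition conv_hull (S : set 'cV[R]_n) : set 'cV[R]_n :=
  [set g | exists (k : nat) (w : 'I_k -> R) (p : 'I_k -> 'cV[R]_n),
     (forall i, 0 <= w i) /\ \sum_(i < k) w i = 1 /\ (forall i, S (p i)) /\
     g = \sum_(i < k) w i *: p i].

Definition clarke_subdiff f ystar : set 'cV[R]_n :=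
  conv_hull (limiting_gradients f ystar).

(* generalized directional derivative
   f°(ybar; d) = limsup_{y -> ybar, t \downarrow 0} (f(y+td) - f(y))/t,
   computed in the extended reals as inf_{del>0} sup_{|y-ybar|<del, 0<t<del} *)
Definition clarke_dd f ybar d : \bar R :=
  ereal_inf [set ereal_sup
     [set r : \bar R | exists (y : 'cV[R]_n) (t : R),
        enorm (y - ybar) < del /\ 0 < t < del /\
        r = ((f (y + t *: d) - f y) / t)%:E]
   | del in [set del : R | 0 < del]].

Definition is_dir_deriv f ybar d (l : R) : Prop :=
  (fun t : R => (f (ybar + t *: d) - f ybar) / t) @ 0^'+ --> l.

Definition clarke_regular f ybar : Prop :=
  forall d, exists l : R, is_dir_deriv f ybar d l /\ clarke_dd f ybar d = l%:E.

Definition tangent_cone (Om : set 'cV[R]_n) ybar : set 'cV[R]_n :=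
  [set d | exists (y : nat -> 'cV[R]_n) (tau : nat -> R),
     (forall k, Om (y k)) /\ (forall k, 0 < tau k) /\
     (fun k => enorm (y k - ybar)) @ \oo --> (0 : R) /\
     tau @ \oo --> (0 : R) /\
     (fun k => enorm ((tau k)^-1 *: (y k - ybar) - d)) @ \oo --> (0 : R)].

Definition interior_of (Om : set 'cV[R]_n) : set 'cV[R]_n :=
  [set y | exists2 e : R, 0 < e & forall x, enorm (x - y) < e -> Om x].

Definition lipconst_on f (Om : set 'cV[R]_n) (L : R) : Prop :=
  forall x y, Om x -> Om y -> `|f x - f y| <= L * enorm (x - y).

End Generic.

Definition relu (R : realType) (t : R) : R := Num.max t 0.

(* columnwise vectorization vec(M) *)
Definition vecc (R : realType) m k (M : 'M[R]_(m, k)) : 'cV[R]_(k * m) :=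
  (mxvec M^T)^T.

Section Problem.
Variables (R : realType) (N N0 N1 : nat) (X : 'M[R]_(N0, N))
          (lam1 lam2 beta theta : R).

(* z = (vec(W); b1; b2; vec(V)) in R^{N2}, N2 = N0 N1 + N1 + N0 + N1 N *)
Definition N2 := (N0 * N1 + N1 + N0 + N * N1)%N.
Notation vZ := 'cV[R]_N2.

Definition Wof (z : vZ) : 'M[R]_(N1, N0) :=
  (vec_mx (usubmx (usubmx (usubmx z)))^T)^T.
Definition b1of (z : vZ) : 'cV[R]_N1 := dsubmx (usubmx (usubmx z)).
Definition b2of (z : vZ) : 'cV[R]_N0 := dsubmx (usubmx z).
Definition bof (z : vZ) : 'cV[R]_(N1 + N0) := col_mx (b1of z) (b2of z).
Definition Vof (z : vZ) : 'M[R]_(N1, N) := (vec_mx (dsubmx z)^T)^T.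

Definition ones m : 'cV[R]_m := const_mx 1.

Definition relu_v m (y : 'cV[R]_m) : 'cV[R]_m := map_mx (@relu R) y.

Definition frob2 m k (M : 'M[R]_(m, k)) : R := \sum_i \sum_j M i j ^+ 2.

Definition mnorm1 m k (M : 'M[R]_(m, k)) : R :=
  \big[Num.max/0]_(j < k) \sum_(i < m) `|M i j|.

Definition Fobj (z : vZ) : R :=
  N%:R^-1 * \sum_(n < N)
     enorm (relu_v ((Wof z)^T *m col n (Vof z) + b2of z) - col n X) ^+ 2.

Definition Robj (z : vZ) : R :=
  lam1 * \sum_(n < N) vdot (ones N1) (col n (Vof z)) + lam2 * frob2 (Wof z).

Definition Pobj (z : vZ) : R :=
  beta * \sum_(n < N)
     vdot (ones N1) (col n (Vof z) - relu_v (Wof z *m col n X + b1of z)).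

Definition Oobj (z : vZ) : R := Fobj z + Robj z + Pobj z.

Definition Omega1 : set vZ :=
  [set z | forall n : 'I_N, col n (Vof z) = relu_v (Wof z *m col n X + b1of z)].
Definition Omega2 : set vZ :=
  [set z | forall (n : 'I_N) (i : 'I_N1),
             relu_v (Wof z *m col n X + b1of z) i 0 <= col n (Vof z) i 0].

Definition alpha : R :=
  Num.max (theta / lam1 + Num.sqrt (N1%:R * N0%:R * theta / lam2) * mnorm1 X)
          (theta * Num.sqrt (N1%:R * N0%:R * theta) / (lam1 * Num.sqrt lam2)
           + Num.sqrt (N%:R * theta) + mnorm1 X).

Definition Omega3 : set vZ :=
  [set z | forall i : 'I_(N1 + N0), `|bof z i 0| <= alpha].
Definition Zset : set vZ := Omega2 `&` Omega3.
Definition Omega_theta : set vZ := [set z | Omega2 z /\ Oobj z <= theta].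

(* nu = 2 (N N1 + N0 + N1);  A z - c = Aff z *)
Definition nu := (N * N1 + N * N1 + (N1 + N0) + (N1 + N0))%N.

Definition Aff (z : vZ) : 'cV[R]_nu :=
  col_mx (col_mx (col_mx
    (vecc (Wof z *m X + b1of z *m (ones N)^T - Vof z))
    (vecc (- Vof z)))
    (bof z - alpha *: ones (N1 + N0)))
    (- bof z - alpha *: ones (N1 + N0)).

Definition cvec : 'cV[R]_nu := - Aff 0.
(* the matrix A: its j-th column is A e_j = Aff e_j + c *)
Definition Amat : 'M[R]_(nu, N2) :=
  \matrix_(k, j) (Aff (delta_mx j 0) + cvec) k 0.

Definition gen_KKT_LRP (zb : vZ) : Prop :=
  Zset zb /\
  exists gam : 'cV[R]_nu,
    (forall k, 0 <= gam k 0) /\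
    (exists2 g, clarke_subdiff Oobj zb g & g + Amat^T *m gam = 0) /\
    (gam^T *m (Amat *m zb - cvec)) 0 0 = 0 /\
    (forall k, (Amat *m zb - cvec) k 0 <= 0).

Definition gen_dstat_R (zb : vZ) : Prop :=
  Omega1 zb /\
  exists2 gR, is_gradient Robj zb gR &
    forall d, tangent_cone Omega1 zb d ->
      (clarke_dd Fobj zb d + (vdot gR d)%:E >= 0)%E.

Definition gen_dstat_RP (zb : vZ) : Prop :=
  Omega2 zb /\
  forall d, tangent_cone Omega2 zb d -> (clarke_dd Oobj zb d >= 0)%E.

Definition gen_dstat_LRP (zb : vZ) : Prop :=
  Zset zb /\
  forall d, tangent_cone Zset zb d -> (clarke_dd Oobj zb d >= 0)%E.

End Problem.

(* Main.v *)
(* A KKT point carries a Clarke subgradient [g] of [O] with [g . (y - zb) >= 0]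
   for every [y] in [Z]; since [O°(zb; d) >= g . d], stationarity for (LRP)
   follows by passing to the tangent cone.  To see that [zb] lies in [Omega1],
   lower [V] to [(W X + b_1)_+] along a direction [d]: the penalty decreases at
   rate at least [beta |d|] while [F + R] varies at rate at most [(LF + LR) |d|],
   so gradients of [O] near [zb] satisfy [g . d <= (LF + LR - beta) |d|], which
   forces [d = 0].  The Lipschitz bounds hold only on [Omega_theta], whereas the
   points defining a limiting gradient may leave [Omega2]; replacing [V] by
   [V + eps] and [b_2] by [b_2 - W^T eps] brings them back, leaves [F] unchanged
   and shifts [R] and [P] by constants.  On the tangent cone of [Omega1] the
   directional derivative of [P] vanishes, hence regularity of [P] turns
   [O°(zb; d) >= 0] into stationarity for (R). *)

Require Import Defs.
From HB Require Import structures.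
From mathcomp Require Import all_boot all_order all_algebra.
From mathcomp Require Import all_classical all_reals.
From mathcomp Require Import ereal topology normedtype sequences.
From mathcomp Require Import ring lra.
Import Order.TTheory GRing.Theory Num.Theory.
Import numFieldNormedType.Exports.
Local Open Scope classical_set_scope.
Local Open Scope ring_scope.
Set Implicit Arguments.
Unset Strict Implicit.
Unset Printing Implicit Defensive.

(** * Euclidean inner product and norm on column vectors *)

Section EuclideanSpace.
Variables (R : realType) (n : nat).
Implicit Types (x y z g d h : 'cV[R]_n) (f : 'cV[R]_n -> R) (Om : set 'cV[R]_n).

Lemma vdotC x y : vdot x y = vdot y x.
Proof. by apply: eq_bigr => i _; rewrite mulrC. Qed.

Lemma vdotDl x y z : vdot (x + y) z = vdot x z + vdot y z.
Proof. by rewrite -big_split; apply: eq_bigr => i _; rewrite mxE mulrDl. Qed.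

Lemma vdotZl a x y : vdot (a *: x) y = a * vdot x y.
Proof. by rewrite mulr_sumr; apply: eq_bigr => i _; rewrite mxE mulrA. Qed.

Lemma vdotDr x y z : vdot x (y + z) = vdot x y + vdot x z.
Proof. by rewrite vdotC vdotDl !(vdotC x). Qed.

Lemma vdotZr a x y : vdot x (a *: y) = a * vdot x y.
Proof. by rewrite vdotC vdotZl vdotC. Qed.

Lemma vdotNr x y : vdot x (- y) = - vdot x y.
Proof. by rewrite -scaleN1r vdotZr mulN1r. Qed.

Lemma vdotBl x y z : vdot (x - y) z = vdot x z - vdot y z.
Proof. by rewrite !(vdotC _ z) vdotDr vdotNr. Qed.

Lemma vdotBr x y z : vdot x (y - z) = vdot x y - vdot x z.
Proof. by rewrite vdotDr vdotNr. Qed.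

Lemma vdot_mulmx x y : vdot x y = (x^T *m y) 0 0.
Proof. by rewrite mxE; apply: eq_bigr => i _; rewrite mxE. Qed.

Lemma vdot_suml k (w : 'I_k -> R) (p : 'I_k -> 'cV[R]_n) d :
  vdot (\sum_(i < k) w i *: p i) d = \sum_(i < k) w i * vdot (p i) d.
Proof.
elim/big_rec2: _ => [|i a b _ <-]; last by rewrite vdotDl vdotZl.
by apply: big1 => i _; rewrite mxE mul0r.
Qed.

(** The values on the standard basis represent a linear form; this later turns the differential of
    [Robj] into a gradient vector. *)
Lemma vdot_linear (l : 'cV[R]_n -> R) :
  {morph l : x y / x + y} -> (forall a x, l (a *: x) = a * l x) ->
  exists g, forall h, vdot g h = l h.
Proof.
move=> lD lZ; exists (\col_i l (delta_mx i 0)) => h.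
have l0 : l 0 = 0 by rewrite -(scale0r 0) lZ mul0r.
have {2}-> : h = \sum_i h i 0 *: delta_mx i 0.
  by rewrite {1}(matrix_sum_delta h); apply: eq_bigr => i _; rewrite big_ord1.
rewrite (big_morph l lD l0); apply: eq_bigr => i _.
by rewrite lZ mxE mulrC.
Qed.

Lemma vdotxx_ge0 x : 0 <= vdot x x.
Proof. by apply: sumr_ge0 => i _; rewrite -expr2 sqr_ge0. Qed.

Lemma enorm_ge0 x : 0 <= enorm x.
Proof. exact: sqrtr_ge0. Qed.

Lemma enorm_sqr x : enorm x ^+ 2 = vdot x x.
Proof. by rewrite sqr_sqrtr // vdotxx_ge0. Qed.

Lemma enormZ a x : enorm (a *: x) = `|a| * enorm x.
Proof.
by rewrite /enorm vdotZl vdotZr mulrA -expr2 sqrtrM ?sqr_ge0 // sqrtr_sqr.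
Qed.

Lemma entry_le_enorm x i : `|x i 0| <= enorm x.
Proof.
rewrite -ler_sqr ?nnegrE ?enorm_ge0 // enorm_sqr real_normK ?num_real //.
rewrite /vdot (bigD1 i) //= -expr2 lerDl; apply: sumr_ge0 => j _.
by rewrite -expr2 sqr_ge0.
Qed.

Lemma enorm_eq0 x : enorm x = 0 -> x = 0.
Proof.
move=> x0; apply/colP => i; rewrite mxE; apply/eqP; rewrite -normr_le0 -x0.
exact: entry_le_enorm.
Qed.

Lemma enorm_le_sum x : enorm x <= \sum_i `|x i 0|.
Proof.
have s0 : 0 <= \sum_i `|x i 0| by apply: sumr_ge0.
rewrite -ler_sqr ?nnegrE ?enorm_ge0 // enorm_sqr expr2 mulr_suml.
apply: ler_sum => i _; apply: (le_trans (ler_norm _)); rewrite normrM.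
by apply: ler_wpM2l => //; rewrite (bigD1 i) //= lerDl; apply: sumr_ge0.
Qed.

Lemma cauchy_schwarz x y : `|vdot x y| <= enorm x * enorm y.
Proof.
have [y0|y0] := eqVneq (vdot y y) 0.
  have -> : y = 0 by apply: enorm_eq0; rewrite /enorm y0 sqrtr0.
  by rewrite -(scale0r 0) vdotZr mul0r normr0 mulr_ge0 ?enorm_ge0.
(* This squared norm equals [vdot y y * (vdot x x * vdot y y - vdot x y ^+ 2)]. *)
have := vdotxx_ge0 (vdot y y *: x - vdot x y *: y).
rewrite vdotBl !vdotBr !vdotZl !vdotZr (vdotC y x) => ge0.
rewrite -ler_sqr ?nnegrE ?mulr_ge0 ?enorm_ge0 // real_normK ?num_real //.
rewrite exprMn !enorm_sqr -subr_ge0.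
have y1 : 0 < vdot y y by rewrite lt_def y0 vdotxx_ge0.
rewrite -(pmulr_rge0 _ y1); congr (0 <= _) : ge0; ring.
Qed.

Lemma enormD x y : enorm (x + y) <= enorm x + enorm y.
Proof.
rewrite -ler_sqr ?nnegrE ?addr_ge0 ?enorm_ge0 // sqrrD !enorm_sqr.
rewrite vdotDl !vdotDr (vdotC y x).
have := le_trans (ler_norm _) (cauchy_schwarz x y); lra.
Qed.

(** Neighbourhoods of matrices are given by entrywise balls; each entry is bounded by [enorm], so
    the Euclidean ball of the same radius fits inside. *)
Lemma nbhs_enorm z (P : set 'cV[R]_n) :
  (\forall y \near z, P y) ->
  exists2 del : R, 0 < del & forall y, enorm (y - z) < del -> P y.
Proof.
move/nbhs_ballP => [del /= del0 sub]; exists del => // y lt; apply: sub.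
split=> // i j; rewrite (ord1 j) /ball /= -normrN opprB.
by apply: le_lt_trans lt; have := entry_le_enorm (y - z) i; rewrite !mxE.
Qed.

End EuclideanSpace.

(** * Clarke subgradients, generalized derivatives and tangent cones *)

Section ClarkeCalculus.
Variables (R : realType) (n : nat).
Implicit Types (x y z g d h : 'cV[R]_n) (f : 'cV[R]_n -> R) (Om : set 'cV[R]_n).

Lemma gradient_diff_quotient f y g d e : is_gradient f y g -> 0 < e ->
  exists2 t0 : R, 0 < t0 &
    forall t, 0 < t < t0 -> `|(f (y + t *: d) - f y) / t - vdot g d| < e.
Proof.
(* Adding 1 keeps the divisor positive when [d = 0]. *)
move=> fg e0; have d1 : 0 < enorm d + 1 by rewrite ltr_wpDl ?enorm_ge0.
have [del del0 Hdel] := fg (e / (enorm d + 1)) (divr_gt0 e0 d1).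
exists (del / (enorm d + 1)); first exact: divr_gt0.
move=> t /andP[t0]; rewrite ltr_pdivlMr // => tdel.
have td : enorm (t *: d) = t * enorm d by rewrite enormZ gtr0_norm.
have /Hdel : enorm (t *: d) < del.
  by rewrite td; apply: le_lt_trans tdel; rewrite ler_pM2l // lerDl.
rewrite vdotZr td => H.
have -> : (f (y + t *: d) - f y) / t - vdot g d
          = (f (y + t *: d) - f y - t * vdot g d) / t.
  by field; rewrite gt_eqF.
rewrite normrM normfV (gtr0_norm t0) ltr_pdivrMr //.
apply: le_lt_trans H _; rewrite mulrAC ltr_pdivrMr // -mulrA ltr_pM2l //.
by rewrite ltr_pM2l // ltrDl.
Qed.

(** An average cannot exceed all the values averaged; estimates on a Clarke subgradient in one
    direction thus reduce to a single limiting gradient. *)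
Lemma conv_hull_dominated (S : set 'cV[R]_n) g d : conv_hull S g ->
  exists2 p, S p & vdot g d <= vdot p d.
Proof.
move=> [k [w [p [w0 [w1 [Sp ->]]]]]]; rewrite vdot_suml; apply: contrapT => H.
set s := \sum_(i < k) _ in H; have ps i : vdot (p i) d < s.
  by rewrite ltNge; apply/negP => le; apply: H; exists (p i).
(* Nonnegative terms with sum zero all vanish; as every gap is positive, every weight would be 0,
   against their sum being 1. *)
have : \sum_(i < k) w i * (s - vdot (p i) d) = 0.
  under eq_bigr do rewrite mulrBr.
  by rewrite sumrB -mulr_suml w1 mul1r subrr.
move/psumr_eq0P => wz.
suff : \sum_(i < k) w i = 0 by rewrite w1 => /eqP; rewrite oner_eq0.
apply: big1 => i _; apply/eqP.
have /eqP := wz (fun j _ => mulr_ge0 (w0 j) (ltW (etrans (subr_gt0 _ _) (ps j)))) i isT.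
by rewrite mulf_eq0 subr_eq0 (gt_eqF (ps i)) orbF.
Qed.

Lemma limiting_gradient_near f z g d (del e : R) :
  limiting_gradients f z g -> 0 < del -> 0 < e ->
  exists y h, [/\ enorm (y - z) < del, is_gradient f y h &
                  vdot g d < vdot h d + e].
Proof.
move=> [y [gs [yg [yz gsg]]]] del0 e0.
have d1 : 0 < enorm d + 1 by rewrite ltr_wpDl ?enorm_ge0.
have /filter_ex [k [yk gk]] : \forall k \near \oo,
    enorm (y k - z) < del /\ enorm (gs k - g) < e / (enorm d + 1).
  near=> k; split; near: k; first exact: cvgr_lt yz _ del0.
  by apply: cvgr_lt gsg _ _; exact: divr_gt0.
exists (y k), (gs k); split => //; rewrite ltr_pdivlMr // in gk.
have : enorm (gs k - g) * enorm d < e.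
  by apply: le_lt_trans gk; rewrite ler_wpM2l ?enorm_ge0 // lerDl.
move/(le_lt_trans (cauchy_schwarz _ _)); rewrite vdotBl ltr_norml => /andP[]; lra.
Unshelve. all: by end_near.
Qed.

(** Arbitrarily near [z] lie points whose gradient along [d] is almost at least [vdot g d], and
    difference quotients there approach that slope for small [t]. So each supremum in [clarke_dd] is
    at least [vdot g d - e]. *)
Lemma clarke_dd_ge f z g d :
  clarke_subdiff f z g -> ((vdot g d)%:E <= clarke_dd f z d)%E.
Proof.
move=> /(conv_hull_dominated d) [p pL gp].
apply: le_ereal_inf_tmp => _ [del /= del0 <-].
apply/lee_subgt0Pr => e e0.
have e2 : 0 < e / 2 by rewrite divr_gt0.
have [y [h [yz fyh ph]]] := limiting_gradient_near d pL del0 e2.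
have [t0 t00 Ht] := gradient_diff_quotient d fyh e2.
pose t := Num.min t0 del / 2.
have m0 : 0 < Num.min t0 del by rewrite lt_min t00.
have : 0 < t < Num.min t0 del by rewrite /t; lra.
rewrite lt_min => /and3P[tgt tt0 tdel].
apply: le_trans (ereal_sup_ubound _); last by exists y, t; rewrite tgt.
rewrite -EFinB lee_fin.
have := Ht t; rewrite tgt tt0 => /(_ isT); rewrite ltr_norml => /andP[+ _]; lra.
Qed.

Lemma clarke_dd_lt f z d r : (clarke_dd f z d < r%:E)%E ->
  exists2 del : R, 0 < del & forall y t, enorm (y - z) < del -> 0 < t < del ->
    (f (y + t *: d) - f y) / t < r.
Proof.
move=> /ereal_inf_lt [_ [del /= del0 <-] sup_lt]; exists del => // y t yz td.
by rewrite -lte_fin; apply: le_lt_trans sup_lt; apply: ereal_sup_ubound; exists y, t.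
Qed.

Lemma clarke_dd_le f z d r del : 0 < del ->
  (forall y t, enorm (y - z) < del -> 0 < t < del ->
    (f (y + t *: d) - f y) / t <= r) ->
  (clarke_dd f z d <= r%:E)%E.
Proof.
move=> del0 H; apply: ge_ereal_inf; eexists; first by exists del => //.
by apply: ge_ereal_sup => _ [y [t [yz [td ->]]]]; rewrite lee_fin; exact: H.
Qed.

(** Subadditivity of the generalized derivative, phrased through real upper bounds so that no sum of
    opposite infinities arises. *)
Lemma clarke_dd_add_le f1 f2 z d a b :
  (clarke_dd f1 z d < a%:E)%E -> (clarke_dd f2 z d < b%:E)%E ->
  (clarke_dd (fun x => (f1 x + f2 x)%R) z d <= (a + b)%:E)%E.
Proof.
move=> /clarke_dd_lt [del1 del10 H1] /clarke_dd_lt [del2 del20 H2].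
apply: (@clarke_dd_le _ _ _ _ (Num.min del1 del2)); first by rewrite lt_min del10.
move=> y t; rewrite !lt_min => /andP[y1 y2] /and3P[t0 t1 t2].
have := H1 y t y1; have := H2 y t y2; rewrite t0 t1 t2 => /(_ isT) + /(_ isT).
rewrite opprD addrACA mulrDl; lra.
Qed.

Lemma tangent_cone_subset Om1 Om2 z :
  Om1 `<=` Om2 -> tangent_cone Om1 z `<=` tangent_cone Om2 z.
Proof.
move=> sub d [y [tau [Oy H]]]; exists y, tau; split => // k; exact/sub/Oy.
Qed.

(** The approximating sequence is eventually in [Om2]; dropping its first [m] terms changes no
    limit. *)
Lemma tangent_cone_interior Om1 Om2 z : interior_of Om2 z ->
  tangent_cone Om1 z `<=` tangent_cone (Om1 `&` Om2) z.
Proof.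
move=> [e e0 He] d [y [tau [Oy [tau0 [yz [tauc yd]]]]]].
have [m _ Hm] : \forall k \near \oo, enorm (y k - z) < e by exact: cvgr_lt yz _ e0.
exists (fun k => y (k + m)%N), (fun k => tau (k + m)%N); split; last split.
- by move=> k; split; [exact: Oy | apply/He/Hm; rewrite /= leq_addl].
- by move=> k; exact: tau0.
split; [|split].
- by rewrite (cvg_shiftn m (fun k => enorm (y k - z))).
- by rewrite cvg_shiftn.
by rewrite (cvg_shiftn m (fun k => enorm ((tau k)^-1 *: (y k - z) - d))).
Qed.

(** The scaled differences converging to [d] pair nonnegatively with [g]; by Cauchy-Schwarz a single
    index close enough to the limit refutes [vdot g d < 0]. *)
Lemma tangent_cone_vdot_ge0 Om z g d : (forall y, Om y -> 0 <= vdot g (y - z)) ->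
  tangent_cone Om z d -> 0 <= vdot g d.
Proof.
move=> Hg [y [tau [Oy [tau0 [_ [_ yd]]]]]]; rewrite leNgt; apply/negP => gd.
have g1 : 0 < enorm g + 1 by rewrite ltr_wpDl ?enorm_ge0.
have e0 : 0 < - vdot g d / (enorm g + 1) by rewrite divr_gt0 ?oppr_gt0.
have /filter_ex [k] : \forall k \near \oo,
    enorm ((tau k)^-1 *: (y k - z) - d) < - vdot g d / (enorm g + 1).
  exact: cvgr_lt yd _ e0.
rewrite ltr_pdivlMr // => lt.
have ge0 : 0 <= vdot g ((tau k)^-1 *: (y k - z)).
  by rewrite vdotZr mulr_ge0 ?Hg // invr_ge0 ltW.
have := le_trans (ler_norm _) (cauchy_schwarz g ((tau k)^-1 *: (y k - z) - d)).
have := enorm_ge0 ((tau k)^-1 *: (y k - z) - d).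
rewrite vdotBr; nra.
Qed.

(* Since [f] vanishes along the approximating points [y k] and at [z], its
   difference quotient at [z] is bounded by [C * enorm (d - (y k - z) / tau k)]. *)
Lemma dir_deriv_tangent_eq0 Om f z d C l :
  (forall x y, `|f x - f y| <= C * enorm (x - y)) ->
  Om z -> (forall y, Om y -> f y = 0) ->
  tangent_cone Om z d -> is_dir_deriv f z d l -> l = 0.
Proof.
move=> fC Omz f0 [y [tau [Oy [tau0 [_ [tauc yd]]]]]] fl.
(* Positivity of [tau k] turns convergence to 0 into convergence from the right, so the one-sided
   limit can be evaluated along [tau]. *)
have tau_right : tau k @[k --> \oo] --> 0^'+.
  move=> A wA; have At : \forall k \near \oo, 0 < tau k -> A (tau k) by exact: tauc wA.
  by apply: filterS At => k; apply; exact: tau0.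
have : (fun k => (f (z + tau k *: d) - f z) / tau k) @ \oo --> l.
  exact: cvg_comp tau_right fl.
move=> /cvg_unique; apply => //.
apply/cvgr0Pnorm_le => e e0.
have C1 : 0 < `|C| + 1 by rewrite ltr_wpDl.
near=> k.
have lt : enorm ((tau k)^-1 *: (y k - z) - d) < e / (`|C| + 1).
  by near: k; apply: cvgr_lt yd _ _; exact: divr_gt0.
have -> : f z = f (y k) by rewrite !f0.
rewrite normrM normfV (gtr0_norm (tau0 k)) ler_pdivrMr ?tau0 //.
apply: le_trans (fC _ _) _.
(* Factoring out [tau k] cancels the denominator and leaves the tangent error, which tends to 0. *)
have -> : z + tau k *: d - y k = (- tau k) *: ((tau k)^-1 *: (y k - z) - d).
  rewrite scalerBr scalerA mulNr divff ?gt_eqF ?tau0 // scaleN1r opprB scaleNr opprK.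
  by rewrite addrAC.
rewrite enormZ normrN gtr0_norm ?tau0 // mulrCA mulrC ler_pM2r ?tau0 //.
rewrite ltr_pdivlMr // in lt; apply: le_trans (ltW lt).
rewrite mulrC ler_wpM2l ?enorm_ge0 //; have := ler_norm C; lra.
Unshelve. all: by end_near.
Qed.

End ClarkeCalculus.

(** * Closure properties of globally Lipschitz functions *)

Section Lipschitz.
Variables (R : realType) (n : nat).
Implicit Types (f : 'cV[R]_n -> R).

Definition lipschitz_fun f := exists C : R, forall x y, `|f x - f y| <= C * enorm (x - y).

Lemma lipschitz_cst a : lipschitz_fun (fun=> a).
Proof. by exists 0 => x y; rewrite subrr normr0 mul0r. Qed.

Lemma lipschitz_entry k : lipschitz_fun (fun z => z k 0).
Proof. by exists 1 => x y; rewrite mul1r; have := entry_le_enorm (x - y) k; rewrite !mxE. Qed.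

Lemma lipschitzD f1 f2 : lipschitz_fun f1 -> lipschitz_fun f2 ->
  lipschitz_fun (fun z => f1 z + f2 z).
Proof.
move=> [C1 H1] [C2 H2]; exists (C1 + C2) => x y.
rewrite opprD addrACA mulrDl; apply: le_trans (ler_normD _ _) _.
by rewrite lerD.
Qed.

Lemma lipschitzZ a f : lipschitz_fun f -> lipschitz_fun (fun z => a * f z).
Proof.
move=> [C H]; exists (`|a| * C) => x y.
by rewrite -mulrBr normrM -mulrA ler_wpM2l.
Qed.

Lemma lipschitz_sum m (F : 'I_m -> 'cV[R]_n -> R) :
  (forall i, lipschitz_fun (F i)) -> lipschitz_fun (fun z => \sum_(i < m) F i z).
Proof.
move=> HF; elim: m F HF => [|m IH] F HF.
  by under eq_fun do rewrite big_ord0; exact: lipschitz_cst.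
by under eq_fun do rewrite big_ord_recl; apply: lipschitzD => //; exact: IH.
Qed.

Lemma relu_lipschitz (a b : R) : `|relu a - relu b| <= `|a - b|.
Proof.
rewrite /relu ler_norml; have := ler_norm (a - b); have := ler_norm (b - a).
by rewrite distrC !maxEle; case: ifP; case: ifP; lra.
Qed.

Lemma lipschitz_relu f : lipschitz_fun f -> lipschitz_fun (fun z => relu (f z)).
Proof. by move=> [C H]; exists C => x y; apply: le_trans (relu_lipschitz _ _) (H x y). Qed.

End Lipschitz.

(** * Closure properties of continuous functions *)

Section Continuity.
Variables (R : realType) (n : nat).
Implicit Types (f : 'cV[R]_n -> R).

Lemma continuous_sumr m (F : 'I_m -> 'cV[R]_n -> R) :
  (forall i, continuous (F i)) -> continuous (fun z => \sum_(i < m) F i z).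
Proof. by move=> HF; apply: continuous_big => [|i _]; [exact: add_continuous|exact: HF]. Qed.

Lemma continuous_addr f1 f2 : continuous f1 -> continuous f2 ->
  continuous (fun z => f1 z + f2 z).
Proof. by move=> H1 H2 z; exact: cvgD (H1 z) (H2 z). Qed.

Lemma continuous_mulr f1 f2 : continuous f1 -> continuous f2 ->
  continuous (fun z => f1 z * f2 z).
Proof. by move=> H1 H2 z; exact: cvgM (H1 z) (H2 z). Qed.

Lemma continuous_relu f : continuous f -> continuous (fun z => relu (f z)).
Proof.
move=> Hf z; apply: (@continuous_max _ _ f (fun=> 0) z (Hf z)).
by apply: cvg_cst; exact: nbhs_filter.
Qed.

End Continuity.

(** * The blocks of [z] and the objective in coordinates *)

Section Autoencoder.
Variables (R : realType) (N N0 N1 : nat) (X : 'M[R]_(N0, N)) (lam1 lam2 beta theta : R).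
Local Notation vZ := 'cV[R]_(N2 N N0 N1).
Local Notation F := (Fobj (N1 := N1) X).
Local Notation Reg := (Robj (N := N) (N0 := N0) (N1 := N1) lam1 lam2).
Local Notation O := (Oobj (N1 := N1) X lam1 lam2 beta).
Local Notation Z := (Zset (N1 := N1) X lam1 lam2 theta).
Implicit Types (x y z d h : vZ) (D : 'M[R]_(N1, N)) (c : 'cV[R]_N0).

(** Hiding the index arithmetic of the vectorization behind some [k] suffices for continuity,
    Lipschitz and norm bounds. *)
Lemma Wof_entry i j : exists k, forall z, Wof z i j = z k 0.
Proof. by eexists => z; rewrite !mxE. Qed.

Lemma b1of_entry i : exists k, forall z, b1of z i 0 = z k 0.
Proof. by eexists => z; rewrite !mxE. Qed.

Lemma b2of_entry i : exists k, forall z, b2of z i 0 = z k 0.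
Proof. by eexists => z; rewrite !mxE. Qed.

Lemma Vof_entry i j : exists k, forall z, Vof z i j = z k 0.
Proof. by eexists => z; rewrite !mxE. Qed.

Lemma Wof_linear a x y : Wof (a *: x + y) = a *: Wof x + Wof y.
Proof. by apply/matrixP => i j; rewrite !mxE. Qed.

Lemma b1of_linear a x y : b1of (a *: x + y) = a *: b1of x + b1of y.
Proof. by apply/colP => i; rewrite !mxE. Qed.

Lemma b2of_linear a x y : b2of (a *: x + y) = a *: b2of x + b2of y.
Proof. by apply/colP => i; rewrite !mxE. Qed.

Lemma Vof_linear a x y : Vof (a *: x + y) = a *: Vof x + Vof y.
Proof. by apply/matrixP => i j; rewrite !mxE. Qed.

Lemma WofD x y : Wof (x + y) = Wof x + Wof y.
Proof. by have := Wof_linear 1 x y; rewrite !scale1r. Qed.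
Lemma b1ofD x y : b1of (x + y) = b1of x + b1of y.
Proof. by have := b1of_linear 1 x y; rewrite !scale1r. Qed.
Lemma b2ofD x y : b2of (x + y) = b2of x + b2of y.
Proof. by have := b2of_linear 1 x y; rewrite !scale1r. Qed.
Lemma VofD x y : Vof (x + y) = Vof x + Vof y.
Proof. by have := Vof_linear 1 x y; rewrite !scale1r. Qed.

(** Displacements of [b_2] by [c] and [V] by [D]; the zero block covers [W] and [b_1] together. *)
Definition pack c D : vZ := col_mx (col_mx 0 c) (vecc D).

Lemma Wof_pack c D : Wof (pack c D) = 0.
Proof. by apply/matrixP => i j; rewrite /Wof /pack !col_mxKu !mxE. Qed.

Lemma b1of_pack c D : b1of (pack c D) = 0.
Proof. by apply/colP => i; rewrite /b1of /pack !col_mxKu !mxE. Qed.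

Lemma b2of_pack c D : b2of (pack c D) = c.
Proof. by rewrite /b2of /pack col_mxKu col_mxKd. Qed.

Lemma Vof_pack c D : Vof (pack c D) = D.
Proof. by rewrite /Vof /pack col_mxKd /vecc trmxK mxvecK trmxK. Qed.

Lemma packZ a c D : pack (a *: c) (a *: D) = a *: pack c D.
Proof. by rewrite /pack !scale_col_mx scaler0 /vecc !linearZ. Qed.

Definition entry_sum D : R := \sum_n \sum_i D i n.

Lemma entry_sumD D1 D2 : entry_sum (D1 + D2) = entry_sum D1 + entry_sum D2.
Proof.
rewrite /entry_sum -big_split; apply: eq_bigr => n _; rewrite -big_split /=.
by apply: eq_bigr => i _; rewrite mxE.
Qed.

Lemma entry_sumZ a D : entry_sum (a *: D) = a * entry_sum D.
Proof.
rewrite /entry_sum mulr_sumr; apply: eq_bigr => n _; rewrite mulr_sumr.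
by apply: eq_bigr => i _; rewrite mxE.
Qed.

(** The Euclidean norm is at most the sum of absolute values, which for nonpositive entries is
    [- entry_sum D]. This is what makes the penalty fall at rate at least [beta] per unit length. *)
Lemma enorm_pack_le D : (forall i n, D i n <= 0) -> enorm (pack 0 D) <= - entry_sum D.
Proof.
move=> D0; apply: le_trans (enorm_le_sum _) _.
rewrite /pack big_split_ord /= big1 ?add0r; last first.
  by move=> i _; rewrite col_mxEu col_mx0 mxE normr0.
rewrite /entry_sum -sumrN; under [leRHS]eq_bigr do rewrite -sumrN.
(* Flattened coordinates are matched with pairs (column, row). *)
rewrite pair_big /= (reindex (uncurry (@mxvec_index N N1))) /=; last exact: curry_mxvec_bij.
apply: ler_sum => -[n i] _ /=; rewrite col_mxEd mxE mxvecE mxE.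
by rewrite ler0_norm.
Qed.

Definition hidden z : 'M[R]_(N1, N) :=
  \matrix_(i, n) relu (\sum_j Wof z i j * X j n + b1of z i 0).

Lemma sub_entry m k (A B : 'M[R]_(m, k)) i j : (A - B) i j = A i j - B i j.
Proof. by rewrite !mxE. Qed.

Lemma hiddenE z n : relu_v (Wof z *m col n X + b1of z) = col n (hidden z).
Proof.
apply/colP => i; rewrite !mxE; congr (relu (_ + _)).
by apply: eq_bigr => j _; rewrite !mxE.
Qed.

Lemma Omega1E z : Omega1 X z <-> Vof z = hidden z.
Proof.
split=> [H|E n]; last by rewrite hiddenE E.
by apply/matrixP => i n; have /colP/(_ i) := H n; rewrite hiddenE !mxE.
Qed.

Lemma Omega2E z : Omega2 X z <-> forall i n, hidden z i n <= Vof z i n.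
Proof.
split=> H; first by move=> i n; have := H n i; rewrite hiddenE !mxE.
by move=> n i; have := H i n; rewrite hiddenE !mxE.
Qed.

Lemma Omega1_sub_Omega2 : Omega1 (N1 := N1) X `<=` Omega2 X.
Proof. by move=> z /Omega1E E; apply/Omega2E => i n; rewrite E. Qed.

Lemma RobjE z : Robj lam1 lam2 z = lam1 * entry_sum (Vof z) + lam2 * frob2 (Wof z).
Proof.
congr (_ * _ + _); apply: eq_bigr => n _; apply: eq_bigr => i _.
by rewrite [col _ _ _ _]mxE mxE mul1r.
Qed.

Lemma PobjE z : Pobj X beta z = beta * entry_sum (Vof z - hidden z).
Proof.
congr (_ * _); apply: eq_bigr => n _; apply: eq_bigr => i _.
by rewrite hiddenE !mxE mul1r.
Qed.

Definition output z : 'M[R]_(N0, N) :=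
  \matrix_(j, n) relu (\sum_i Wof z i j * Vof z i n + b2of z j 0).

Lemma FobjE z :
  Fobj X z = N%:R^-1 * \sum_n \sum_j (output z j n - X j n) * (output z j n - X j n).
Proof.
congr (_ * _); apply: eq_bigr => n _; rewrite enorm_sqr; apply: eq_bigr => j _.
by congr (_ * _); rewrite !mxE; congr (relu (_ + _) - _); apply: eq_bigr => i _; rewrite !mxE.
Qed.

(** * Continuity of the objective and Lipschitz continuity of the penalty *)

Lemma continuous_Wof i j : continuous (fun z => Wof z i j).
Proof. by have [k E] := Wof_entry i j; under eq_fun do rewrite E; exact: coord_continuous. Qed.
Lemma continuous_b1of i : continuous (fun z => b1of z i 0).
Proof. by have [k E] := b1of_entry i; under eq_fun do rewrite E; exact: coord_continuous. Qed.
Lemma continuous_b2of i : continuous (fun z => b2of z i 0).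
Proof. by have [k E] := b2of_entry i; under eq_fun do rewrite E; exact: coord_continuous. Qed.
Lemma continuous_Vof i j : continuous (fun z => Vof z i j).
Proof. by have [k E] := Vof_entry i j; under eq_fun do rewrite E; exact: coord_continuous. Qed.

Lemma continuous_hidden i n : continuous (fun z => hidden z i n).
Proof.
under eq_fun do rewrite mxE; apply/continuous_relu/continuous_addr.
  apply: continuous_sumr => j; apply: continuous_mulr; first exact: continuous_Wof.
  exact: cst_continuous.
exact: continuous_b1of.
Qed.

Lemma continuous_output i n : continuous (fun z => output z i n).
Proof.
under eq_fun do rewrite mxE; apply/continuous_relu/continuous_addr.
  apply: continuous_sumr => j; apply: continuous_mulr; first exact: continuous_Wof.
  exact: continuous_Vof.
exact: continuous_b2of.
Qed.

Lemma continuous_Oobj : continuous O.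
Proof.
have -> : O = fun z =>
    (N%:R^-1 * \sum_n \sum_j (output z j n - X j n) * (output z j n - X j n) +
     (lam1 * entry_sum (Vof z) + lam2 * frob2 (Wof z))) +
    beta * entry_sum (Vof z - hidden z).
  by apply: funext => z; rewrite /Oobj FobjE RobjE PobjE.
have cc (a : R) : continuous (fun _ : vZ => a) by exact: cst_continuous.
have cO j n : continuous (fun z => output z j n - X j n).
  by apply: continuous_addr => //; exact: continuous_output.
apply: continuous_addr; first apply: continuous_addr.
- apply: continuous_mulr => //; apply: continuous_sumr => n.
  by apply: continuous_sumr => j; apply: continuous_mulr.
- apply: continuous_addr; apply: continuous_mulr => //.
    by apply: continuous_sumr => n; apply: continuous_sumr => j; exact: continuous_Vof.
  apply: continuous_sumr => n; apply: continuous_sumr => j.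
  by apply: continuous_mulr; exact: continuous_Wof.
apply: continuous_mulr => //; apply: continuous_sumr => n; apply: continuous_sumr => j.
under eq_fun do rewrite sub_entry -mulN1r.
apply: continuous_addr; first exact: continuous_Vof.
by apply: continuous_mulr => //; exact: continuous_hidden.
Qed.

Lemma lipschitz_Pobj : lipschitz_fun (Pobj (N1 := N1) X beta).
Proof.
have -> : Pobj (N1 := N1) X beta = fun z => beta * \sum_n \sum_i
    (Vof z i n + -1 * relu (\sum_j X j n * Wof z i j + b1of z i 0)).
  apply: funext => z; rewrite PobjE; congr (_ * _); apply: eq_bigr => n _.
  apply: eq_bigr => i _; rewrite sub_entry [hidden _ _ _]mxE mulN1r; congr (_ - relu (_ + _)).
  by apply: eq_bigr => j _; rewrite mulrC.
apply: lipschitzZ; apply: lipschitz_sum => n; apply: lipschitz_sum => i.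
apply: lipschitzD.
  by have [k E] := Vof_entry i n; under eq_fun do rewrite E; exact: lipschitz_entry.
apply/lipschitzZ/lipschitz_relu/lipschitzD.
  apply: lipschitz_sum => j; apply: lipschitzZ.
  by have [k E] := Wof_entry i j; under eq_fun do rewrite E; exact: lipschitz_entry.
by have [k E] := b1of_entry i; under eq_fun do rewrite E; exact: lipschitz_entry.
Qed.

(** * Displacements that fix [W] and [b_1] *)

Lemma Robj_pack y c D :
  Robj lam1 lam2 (y + pack c D) = Robj lam1 lam2 y + lam1 * entry_sum D.
Proof. by rewrite !RobjE WofD VofD Wof_pack Vof_pack addr0 entry_sumD mulrDr addrAC. Qed.

Lemma hidden_pack y c D : hidden (y + pack c D) = hidden y.
Proof. by rewrite /hidden WofD b1ofD Wof_pack b1of_pack !addr0. Qed.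

Lemma Pobj_pack y c D :
  Pobj X beta (y + pack c D) = Pobj X beta y + beta * entry_sum D.
Proof. by rewrite !PobjE hidden_pack VofD Vof_pack -mulrDr -entry_sumD addrAC. Qed.

(* Translating every [v_n] by [eps *: ones] and compensating through [b_2]
   leaves [W^T v_n + b_2], hence [F], unchanged. *)
Definition lift_codes (eps : R) y : vZ :=
  y + pack (- ((Wof y)^T *m const_mx eps)) (const_mx eps).

Lemma Fobj_lift_codes eps y : Fobj X (lift_codes eps y) = Fobj X y.
Proof.
congr (_ * _); apply: eq_bigr => n _; congr (enorm (relu_v _ - _) ^+ 2).
rewrite /lift_codes WofD b2ofD VofD Wof_pack b2of_pack Vof_pack addr0.
have -> : col n (Vof y + const_mx eps) = col n (Vof y) + const_mx eps.
  by apply/colP => i; rewrite !mxE.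
by rewrite mulmxDr addrACA subrr addr0.
Qed.

Lemma lift_codes_pack eps y D : lift_codes eps (y + pack 0 D) = lift_codes eps y + pack 0 D.
Proof. by rewrite /lift_codes WofD Wof_pack addr0 addrAC. Qed.


(** * The affine constraints and the variational form of the KKT conditions *)

Lemma vecc_linear m k a (A B : 'M[R]_(m, k)) : vecc (a *: A + B) = a *: vecc A + vecc B.
Proof. by rewrite /vecc !linearP. Qed.

Definition Aff_lin z : 'cV[R]_(nu N N0 N1) :=
  col_mx (col_mx (col_mx
    (vecc (Wof z *m X + b1of z *m (ones R N)^T - Vof z)) (vecc (- Vof z)))
    (bof z)) (- bof z).

Lemma Aff_lin_linear a x y : Aff_lin (a *: x + y) = a *: Aff_lin x + Aff_lin y.
Proof.
rewrite /Aff_lin !scale_col_mx !add_col_mx -!vecc_linear.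
rewrite /bof Wof_linear b1of_linear b2of_linear Vof_linear.
congr (col_mx (col_mx (col_mx (vecc _) (vecc _)) _) _).
- rewrite !mulmxDl -!scalemxAl !scalerDr scalerN opprD.
  by rewrite (addrACA (a *: (Wof x *m X))) [LHS]addrACA.
- by rewrite opprD scalerN.
- by rewrite scalerN -opprD scale_col_mx add_col_mx.
Qed.

Lemma AffE z : Aff X lam1 lam2 theta z = Aff_lin z + Aff X lam1 lam2 theta 0.
Proof.
have l0 : Aff_lin 0 = 0.
  by have := Aff_lin_linear (-1) 0 0; rewrite addr0 scaler0 scaleN1r addNr.
suff AE y : Aff X lam1 lam2 theta y = Aff_lin y + col_mx (col_mx 0
    (- (alpha N1 X lam1 lam2 theta *: ones R _)))
    (- (alpha N1 X lam1 lam2 theta *: ones R _)) by rewrite !AE l0 add0r.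
by rewrite /Aff /Aff_lin !add_col_mx addr0.
Qed.

(** The columns of [Amat] are the values of [Aff_lin] on the standard basis, so by linearity [Amat]
    acts as [Aff_lin]. *)
Lemma Amat_mulE z :
  Amat N1 X lam1 lam2 theta *m z - cvec N1 X lam1 lam2 theta = Aff X lam1 lam2 theta z.
Proof.
rewrite AffE /cvec opprK; congr (_ + _).
have lD x y : Aff_lin (x + y) = Aff_lin x + Aff_lin y.
  by have := Aff_lin_linear 1 x y; rewrite !scale1r.
have l0 : Aff_lin 0 = 0 by apply: (addrI (Aff_lin 0)); rewrite -lD !addr0.
have lZ a x : Aff_lin (a *: x) = a *: Aff_lin x.
  by have := Aff_lin_linear a x 0; rewrite l0 !addr0.
have {2}-> : z = \sum_j z j 0 *: delta_mx j 0.
  by rewrite {1}(matrix_sum_delta z); apply: eq_bigr => i _; rewrite big_ord1.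
rewrite (big_morph _ lD l0); apply/colP => k; rewrite mxE summxE.
apply: eq_bigr => j _; rewrite lZ mxE AffE /cvec addrK [RHS]mxE mulrC.
by [].
Qed.

Lemma opp_entry m k (A : 'M[R]_(m, k)) i j : (- A) i j = - A i j.
Proof. by rewrite mxE. Qed.

Lemma ones_entry m a k : (a *: ones R m) k 0 = a.
Proof. by rewrite !mxE mulr1. Qed.

Lemma Aff_le0 z : Z z -> forall k, Aff X lam1 lam2 theta z k 0 <= 0.
Proof.
move=> [/Omega2E z2 z3] k; rewrite /Aff.
have relu_ge (t : R) : t <= relu t by rewrite le_max lexx.
have relu_ge0 (t : R) : 0 <= relu t by rewrite le_max lexx orbT.
case: (split_ordP k) => {k} k ->; rewrite ?col_mxEu ?col_mxEd; last first.
  by have := z3 k; rewrite sub_entry opp_entry ones_entry ler_norml => /andP[]; lra.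
case: (split_ordP k) => {k} k ->; rewrite ?col_mxEu ?col_mxEd; last first.
  by have := z3 k; rewrite sub_entry ones_entry ler_norml => /andP[]; lra.
case: (split_ordP k) => {k} k ->; rewrite ?col_mxEu ?col_mxEd /vecc mxE;
  case/mxvec_indexP: k => n i; rewrite mxvecE mxE.
  rewrite sub_entry subr_le0; apply: le_trans (z2 i n).
  rewrite [hidden _ _ _]mxE; apply: le_trans (relu_ge _).
  by rewrite mxE [X in _ + X]mxE big_ord1 !mxE mulr1.
rewrite mxE oppr_le0; apply: le_trans (z2 i n); rewrite [hidden _ _ _]mxE.
exact: relu_ge0.
Qed.

(** With [g = - A^T gam], complementarity reduces [vdot g (y - zb)] to [- gam^T (A y - c)], which is
    nonnegative for feasible [y]. *)
Lemma KKT_variational zb : gen_KKT_LRP X lam1 lam2 beta theta zb ->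
  exists2 g, clarke_subdiff O zb g & forall y, Z y -> 0 <= vdot g (y - zb).
Proof.
move=> [_ [gam [gam0 [[g gO gA] [comp _]]]]]; exists g => // y Zy.
have -> : g = - ((Amat N1 X lam1 lam2 theta)^T *m gam) by apply/eqP; rewrite -addr_eq0 gA.
rewrite vdot_mulmx linearN /= trmx_mul trmxK mulNmx mxE -mulmxA mulmxBr.
have -> : Amat N1 X lam1 lam2 theta *m y - Amat N1 X lam1 lam2 theta *m zb =
    Aff X lam1 lam2 theta y - (Amat N1 X lam1 lam2 theta *m zb - cvec N1 X lam1 lam2 theta).
  by rewrite -Amat_mulE opprB addrA subrK.
rewrite mulmxBr sub_entry comp subr0 oppr_ge0 -vdot_mulmx.
by apply: sumr_le0 => k _; rewrite mulr_ge0_le0 // Aff_le0.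
Qed.

(** * Descent of the objective along directions that lower [V] *)

Lemma Oobj_lift_codes eps y : O (lift_codes eps y) =
  O y + eps * ((lam1 + beta) * entry_sum (const_mx 1 : 'M_(N1, N))).
Proof.
have E : (const_mx eps : 'M[R]_(N1, N)) = eps *: const_mx 1.
  by apply/matrixP => i j; rewrite !mxE mulr1.
by rewrite /Oobj Fobj_lift_codes /lift_codes Robj_pack Pobj_pack E entry_sumZ; ring.
Qed.

(** Continuity at [zb]; the second bound says exactly that [lift_codes eps y] lies in [Omega2]. *)
Lemma Oobj_near zb eps : Omega2 X zb -> 0 < eps ->
  exists2 del : R, 0 < del & forall y, enorm (y - zb) < del ->
    O y < O zb + eps /\ forall i n, hidden y i n <= Vof y i n + eps.
Proof.
move=> /Omega2E zb2 e0; apply: nbhs_enorm.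
have nO : \forall y \near zb, O y < O zb + eps.
  by apply: (cvgr_lt _ (@continuous_Oobj zb)); rewrite ltrDl.
have nH (p : 'I_N1 * 'I_N) : \forall y \near zb, hidden y p.1 p.2 + -1 * Vof y p.1 p.2 < eps.
  have cont : continuous (fun y => hidden y p.1 p.2 + -1 * Vof y p.1 p.2).
    apply: continuous_addr; first exact: continuous_hidden.
    by apply: continuous_mulr; [exact: cst_continuous|exact: continuous_Vof].
  apply: (cvgr_lt _ (cont zb)); rewrite mulN1r.
  by apply: le_lt_trans e0; rewrite subr_le0.
have nH' : \forall y \near zb, forall p : 'I_N1 * 'I_N,
    hidden y p.1 p.2 + -1 * Vof y p.1 p.2 < eps
    by exact: (filter_forall (nbhs_filter zb) nH).
apply: filterS2 nO nH' => y yO yH; split => // i n.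
by have /= := yH (i, n); lra.
Qed.

Lemma gradient_descent LF LR zb D : 0 < lam1 -> 0 < beta ->
  lipconst_on F (Omega_theta X lam1 lam2 beta theta) LF ->
  lipconst_on Reg (Omega_theta X lam1 lam2 beta theta) LR ->
  Omega2 X zb -> O zb < theta -> (forall i n, D i n <= 0) ->
  exists2 del : R, 0 < del & forall y g, enorm (y - zb) < del -> is_gradient O y g ->
    vdot g (pack 0 D) <= (LF + LR - beta) * enorm (pack 0 D : vZ).
Proof.
move=> lam10 beta0 lipF lipR zb2 zbO D0.
set k := (lam1 + beta) * entry_sum (const_mx 1 : 'M[R]_(N1, N)).
have k0 : 0 <= k.
  rewrite mulr_ge0 ?addr_ge0 ?(ltW lam10) ?(ltW beta0) //; apply: sumr_ge0 => n _.
  by apply: sumr_ge0 => i _; rewrite mxE.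
(* Chosen so that [O zb + eps + eps * k = theta]: points where [O] is below [O zb + eps] remain at
   level at most [theta] after lifting. *)
pose eps := (theta - O zb) / (k + 1).
have k1 : 0 < k + 1 by lra.
have eps0 : 0 < eps by rewrite divr_gt0 // subr_gt0.
have epsE : eps * (k + 1) = theta - O zb by rewrite divfK // gt_eqF.
have [del del0 near_zb] := Oobj_near zb2 eps0; exists del => // y g ydel gy.
have lifted x : enorm (x - zb) < del -> Omega_theta X lam1 lam2 beta theta (lift_codes eps x).
  move=> /near_zb [xO xH]; split.
    apply/Omega2E => i n; rewrite hidden_pack VofD Vof_pack [leRHS]mxE [X in _ + X]mxE.
    exact: xH.
  rewrite Oobj_lift_codes -/k; nra.
set d : vZ := pack 0 D.
apply/ler_addgt0Pr => e e0.
have [t0 t00 Ht] := gradient_diff_quotient d gy e0.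
(* For [t < s] the point [y + t *: d] stays within [del] of [zb]. *)
pose s := (del - enorm (y - zb)) / (enorm d + 1).
have d1 : 0 < enorm d + 1 by rewrite ltr_wpDl ?enorm_ge0.
have s0 : 0 < s by rewrite divr_gt0 ?subr_gt0.
pose t := Num.min t0 s / 2.
have m0 : 0 < Num.min t0 s by rewrite lt_min t00.
have : 0 < t < Num.min t0 s by rewrite /t; lra.
rewrite lt_min => /and3P[tgt tt0 ts].
have := Ht t; rewrite tgt tt0 => /(_ isT); rewrite ltr_norml => /andP[lower _].
suff : (O (y + t *: d) - O y) / t <= (LF + LR - beta) * enorm d by lra.
have td : enorm (t *: d) = t * enorm d by rewrite enormZ gtr0_norm.
have ytdel : enorm (y + t *: d - zb) < del.
  rewrite addrAC; apply: le_lt_trans (enormD _ _) _; rewrite td.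
  move: ts; rewrite ltr_pdivlMr //; nra.
(* Lifting adds the same constant at both points, so the increment can be measured inside
   [Omega_theta], where the Lipschitz bounds hold. *)
have -> : O (y + t *: d) - O y = O (lift_codes eps (y + t *: d)) - O (lift_codes eps y).
  by rewrite !Oobj_lift_codes; ring.
have tE : t *: d = pack 0 (t *: D) by rewrite -packZ scaler0.
have liftE : lift_codes eps (y + t *: d) = lift_codes eps y + t *: d.
  by rewrite tE lift_codes_pack.
have := lipF _ _ (lifted _ ytdel) (lifted _ ydel).
have := lipR _ _ (lifted _ ytdel) (lifted _ ydel).
have addrKl (a b : vZ) : a + b - a = b by rewrite addrAC subrr add0r.
rewrite liftE addrKl td => /(le_trans (ler_norm _)) HR /(le_trans (ler_norm _)) HF.
have HP : Pobj X beta (lift_codes eps y + t *: d) - Pobj X beta (lift_codes eps y)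
          <= - beta * (t * enorm d).
  rewrite {1}tE Pobj_pack entry_sumZ (addrC (Pobj _ _ _)) addrK.
  have := enorm_pack_le D0; rewrite -/d => Hd.
  have : 0 <= beta * t * (- entry_sum D - enorm d) 
    by apply: mulr_ge0; [exact/ltW/mulr_gt0|rewrite subr_ge0].
  nra.
rewrite ler_pdivrMr // /Oobj; lra.
Qed.

(** * Differentiability of the regularizer *)

Definition mdot m k (A B : 'M[R]_(m, k)) : R := \sum_i \sum_j A i j * B i j.

Lemma mdotDr m k (A B C : 'M[R]_(m, k)) : mdot A (B + C) = mdot A B + mdot A C.
Proof.
rewrite /mdot -big_split; apply: eq_bigr => i _; rewrite -big_split /=.
by apply: eq_bigr => j _; rewrite mxE mulrDr.
Qed.

Lemma mdotZr m k (a : R) (A B : 'M[R]_(m, k)) : mdot A (a *: B) = a * mdot A B.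
Proof.
rewrite /mdot mulr_sumr; apply: eq_bigr => i _; rewrite mulr_sumr.
by apply: eq_bigr => j _; rewrite mxE mulrCA.
Qed.

Lemma mdotC m k (A B : 'M[R]_(m, k)) : mdot A B = mdot B A.
Proof. by apply: eq_bigr => i _; apply: eq_bigr => j _; rewrite mulrC. Qed.

Lemma frob2D m k (A B : 'M[R]_(m, k)) :
  frob2 (A + B) = frob2 A + 2 * mdot A B + frob2 B.
Proof.
have E (C : 'M[R]_(m, k)) : frob2 C = mdot C C by [].
by rewrite !E mdotDr !(mdotC (A + B)) !mdotDr (mdotC B A); ring.
Qed.

Lemma mdot_Wof_le (A : 'M[R]_(N1, N0)) h :
  `|mdot A (Wof h)| <= (\sum_i \sum_j `|A i j|) * enorm h.
Proof.
rewrite /mdot mulr_suml; apply: le_trans (ler_norm_sum _ _ _) _.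
apply: ler_sum => i _; rewrite mulr_suml; apply: le_trans (ler_norm_sum _ _ _) _.
apply: ler_sum => j _; rewrite normrM ler_wpM2l //.
by have [k ->] := Wof_entry i j; exact: entry_le_enorm.
Qed.

Lemma frob2_Wof_le h : frob2 (Wof h) <= (N1%:R * N0%:R) * enorm h ^+ 2.
Proof.
have -> : N1%:R * N0%:R * enorm h ^+ 2 = \sum_(i < N1) \sum_(j < N0) enorm h ^+ 2.
  by rewrite !sumr_const !card_ord -[RHS]mulr_natl -[in RHS](mulr_natl (_ ^+ 2)) mulrA.
apply: ler_sum => i _; apply: ler_sum => j _.
have [k ->] := Wof_entry i j; rewrite -real_normK ?num_real //.
by rewrite ler_sqr ?nnegrE ?enorm_ge0 // entry_le_enorm.
Qed.

(** The differential of [Robj] at [z], applied to [h]. *)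
Definition Robj_diff z h : R := lam1 * entry_sum (Vof h) + 2 * lam2 * mdot (Wof z) (Wof h).

Lemma RobjD z h : Reg (z + h) = Reg z + Robj_diff z h + lam2 * frob2 (Wof h).
Proof. by rewrite !RobjE VofD WofD entry_sumD frob2D /Robj_diff; ring. Qed.

Lemma Robj_diffZ z a h : Robj_diff z (a *: h) = a * Robj_diff z h.
Proof.
have -> : a *: h = a *: h + 0 by rewrite addr0.
have V0 : Vof (0 : vZ) = 0 by apply/matrixP => i j; rewrite !mxE.
have W0 : Wof (0 : vZ) = 0 by apply/matrixP => i j; rewrite !mxE.
by rewrite /Robj_diff Vof_linear Wof_linear V0 W0 !addr0 entry_sumZ mdotZr; ring.
Qed.

Lemma Robj_gradient z : 0 < lam2 ->
  exists2 g, is_gradient Reg z g & forall h, vdot g h = Robj_diff z h.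
Proof.
move=> lam20; have [g gE] : exists g, forall h, vdot g h = Robj_diff z h.
  apply: vdot_linear => [x y|a x]; last exact: Robj_diffZ.
  by rewrite /Robj_diff VofD WofD entry_sumD mdotDr; ring.
exists g => // e e0; set K := lam2 * (N1%:R * N0%:R).
have K0 : 0 <= K by rewrite mulr_ge0 ?(ltW lam20) // mulr_ge0.
(* The remainder is at most [K * enorm h ^+ 2], hence at most [e * enorm h] within this radius. *)
exists (e / (K + 1)); first by rewrite divr_gt0 // ltr_wpDl.
move=> h; rewrite ltr_pdivlMr ?ltr_wpDl // => hlt.
rewrite gE RobjD (_ : _ - _ - _ = lam2 * frob2 (Wof h)); last by ring.
have f0 : 0 <= frob2 (Wof h).
  by apply: sumr_ge0 => i _; apply: sumr_ge0 => j _; exact: sqr_ge0.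
rewrite ger0_norm ?mulr_ge0 ?(ltW lam20) //.
have : lam2 * frob2 (Wof h) <= K * enorm h ^+ 2.
  by rewrite -mulrA ler_wpM2l ?(ltW lam20) // frob2_Wof_le.
have := enorm_ge0 h; nra.
Qed.

(** The quotient at a nearby [y] exceeds [Robj_diff z d] by at most [2 * lam2 * A * enorm (y - z) +
    lam2 * B * t], a bound that is small with [enorm (y - z)] and [t]. *)
Lemma Robj_clarke_lt z d e : 0 < lam2 -> 0 < e ->
  (clarke_dd Reg z d < (Robj_diff z d + e)%:E)%E.
Proof.
move=> lam20 e0.
set A := \sum_i \sum_j `|Wof d i j|; set B := frob2 (Wof d).
have A0 : 0 <= A by apply: sumr_ge0 => i _; apply: sumr_ge0.
have B0 : 0 <= B by apply: sumr_ge0 => i _; apply: sumr_ge0 => j _; exact: sqr_ge0.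
set K := lam2 * (2 * A + B).
have K0 : 0 <= K by rewrite mulr_ge0 ?(ltW lam20) //; lra.
have K1 : 0 < K + 1 by lra.
apply: (@le_lt_trans _ _ (Robj_diff z d + e / 2)%:E); last by rewrite lte_fin; lra.
apply: (@clarke_dd_le _ _ _ _ _ _ (e / 2 / (K + 1))); first by rewrite !divr_gt0.
move=> y t; rewrite !ltr_pdivlMr // => yz /andP[t0 tlt].
have -> : (Reg (y + t *: d) - Reg y) / t = Robj_diff y d + t * (lam2 * B).
  rewrite RobjD Robj_diffZ.
  have -> : frob2 (Wof (t *: d)) = t ^+ 2 * B.
    rewrite /B /frob2 mulr_sumr; apply: eq_bigr => i _; rewrite mulr_sumr.
    apply: eq_bigr => j _; have [k E] := Wof_entry i j; rewrite !E mxE; ring.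
  by field; rewrite gt_eqF.
have -> : Robj_diff y d = Robj_diff z d + 2 * lam2 * mdot (Wof d) (Wof (y - z)).
  have {1}-> : y = z + (y - z) by rewrite addrC subrK.
  by rewrite /Robj_diff WofD mdotC mdotDr mdotC; ring.
have := le_trans (ler_norm _) (mdot_Wof_le (Wof d) (y - z)); rewrite -/A => HA.
have H1 : 0 <= lam2 * (A * enorm (y - z) - mdot (Wof d) (Wof (y - z))).
  by rewrite mulr_ge0 ?(ltW lam20) // subr_ge0.
have m := enorm_ge0 (y - z).
(* The larger of the two small quantities, multiplied by [K], bounds the excess. *)
have [le|le] := leP t (enorm (y - z)).
  have : 0 <= lam2 * B * (enorm (y - z) - t) by rewrite !mulr_ge0 ?(ltW lam20) // subr_ge0.
  rewrite /K in yz; nra.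
have : 0 <= lam2 * A * (t - enorm (y - z)) by rewrite !mulr_ge0 ?(ltW lam20) // subr_ge0 ltW.
rewrite /K in tlt; nra.
Qed.

Lemma clarke_Oobj_ge0 z d : 0 < lam2 ->
  (0 <= clarke_dd O z d)%E -> clarke_dd (Pobj X beta) z d = 0%E ->
  (0 <= clarke_dd F z d + (Robj_diff z d)%:E)%E.
Proof.
move=> lam20 O0 P0; rewrite leNgt; apply/negP => lt.
(* A real number is inserted because the generalized derivative of [F] could a priori be
   infinite. *)
have [a [Fa aR]] : exists a : R, (clarke_dd F z d < a%:E)%E /\ a + Robj_diff z d < 0.
  move: lt; case: (clarke_dd F z d) => [r|//|_].
    rewrite -EFinD lte_fin => lt; exists ((r - Robj_diff z d) / 2).
    by rewrite lte_fin; split; lra.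
  by exists (- Robj_diff z d - 1); rewrite ltNyr; split => //; lra.
(* The three slacks [e], [e / 2] and [e] add up to less than the gap [3 * e]. *)
pose e := - (a + Robj_diff z d) / 3; have e0 : 0 < e by rewrite /e; lra.
have Pe : (clarke_dd (Pobj X beta) z d < e%:E)%E by rewrite P0 lte_fin.
have FR := clarke_dd_add_le Fa (Robj_clarke_lt z d lam20 e0).
have FRlt : (clarke_dd (fun x => F x + Reg x)%R z d < (a + (Robj_diff z d + e) + e / 2)%:E)%E.
  by apply: le_lt_trans FR _; rewrite lte_fin; lra.
have := le_trans O0 (clarke_dd_add_le FRlt Pe); rewrite lee_fin /e; lra.
Qed.

End Autoencoder.

(** * Exactness of the penalty at KKT points and the stationarity conclusions *)

Theorem theorem2p4 (R : realType) (N N0 N1 : nat) (X : 'M[R]_(N0, N))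
    (lam1 lam2 beta theta LF LR : R) (zb : 'cV[R]_(N2 N N0 N1)) :
  (0 < N)%N -> (0 < N0)%N -> (0 < N1)%N ->
  0 < lam1 -> 0 < lam2 -> 0 < beta ->
  N%:R^-1 * frob2 X < theta ->
  lipconst_on (Fobj (N1:=N1) X) (Omega_theta (N1:=N1) X lam1 lam2 beta theta) LF ->
  lipconst_on (Robj (N:=N) (N0:=N0) (N1:=N1) lam1 lam2) (Omega_theta (N1:=N1) X lam1 lam2 beta theta) LR ->
  LF + LR < beta ->
  Zset X lam1 lam2 theta zb ->
  Oobj X lam1 lam2 beta zb < theta ->
  gen_KKT_LRP X lam1 lam2 beta theta zb ->
  [/\ Omega1 X zb,
      gen_dstat_LRP X lam1 lam2 beta theta zb,
      interior_of (Omega3 (N1:=N1) X lam1 lam2 theta) zb ->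
        gen_dstat_RP X lam1 lam2 beta zb &
      interior_of (Omega3 (N1:=N1) X lam1 lam2 theta) zb ->
      clarke_regular (Pobj (N1:=N1) X beta) zb ->
        gen_dstat_R X lam1 lam2 zb].
Proof.
move=> _ _ _ lam10 lam20 beta0 _ lipF lipR betaL [zb2 zb3] zbO kkt.
have [g gO g_var] := KKT_variational kkt.
have zb1 : Omega1 X zb.
  pose D := hidden X zb - Vof zb.
  have D0 i n : D i n <= 0 by rewrite sub_entry subr_le0; exact: (Omega2E X zb).1.
  have [del del0 Hdel] := gradient_descent lam10 beta0 lipF lipR zb2 zbO D0.
  set d := pack 0 D in Hdel.
  (* The point [zb + d] has [V] equal to [hidden X zb] and the same [b], so it is feasible and the
     variational inequality applies. *)
  have gd : 0 <= vdot g d.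
    have -> : d = zb + d - zb by rewrite addrAC subrr add0r.
    apply: g_var; split.
      by apply/Omega2E => i n; rewrite hidden_pack VofD Vof_pack addrC subrK.
    by move=> i; rewrite /bof b1ofD b2ofD b1of_pack b2of_pack !addr0; exact: zb3.
  have [p pL gp] := conv_hull_dominated d gO.
  have d_le e : 0 < e -> 0 <= (LF + LR - beta) * enorm d + e.
    move=> e0; have [y [h [yz hy ph]]] := limiting_gradient_near d pL del0 e0.
    by have := Hdel y h yz hy; lra.
  have nd : 0 <= (LF + LR - beta) * enorm d by apply/ler_addgt0Pr.
  (* The coefficient [LF + LR - beta] is negative. *)
  have d0 : d = 0 by apply: enorm_eq0; have := enorm_ge0 d; nra.
  apply/Omega1E/eqP; rewrite eq_sym -subr_eq0 -/D -(Vof_pack (0 : 'cV_N0) D) -/d d0.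
  by apply/eqP/matrixP => i n; rewrite !mxE.
have statLRP : gen_dstat_LRP X lam1 lam2 beta theta zb.
  split=> // d dT; apply: le_trans (clarke_dd_ge d gO).
  by rewrite lee_fin; exact: tangent_cone_vdot_ge0 g_var dT.
have statRP : interior_of (Omega3 (N1:=N1) X lam1 lam2 theta) zb ->
    gen_dstat_RP X lam1 lam2 beta zb.
  by move=> int3; split=> // d dT; apply: statLRP.2; exact: tangent_cone_interior dT.
split=> // int3 regP; split=> //.
have [gR gradR gRE] := Robj_gradient lam1 zb lam20; exists gR => // d dT.
rewrite gRE; apply: (clarke_Oobj_ge0 lam20).
  by apply: (statRP int3).2; exact: tangent_cone_subset (@Omega1_sub_Omega2 _ _ _ _ _) _ dT.
(* Regularity replaces the generalized derivative of [Pobj] by the one-sided one, which is 0 since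
   [Pobj] vanishes on [Omega1]. *)
have [l [dl ->]] := regP d.
have P0 (y : 'cV[R]_(N2 N N0 N1)) : Omega1 X y -> Pobj X beta y = 0.
  move=> /Omega1E E; rewrite PobjE E subrr -(scale0r 0) entry_sumZ mul0r.
  exact: mulr0.
have [C PC] := @lipschitz_Pobj _ _ _ N1 X beta.
by rewrite (dir_deriv_tangent_eq0 PC zb1 P0 dT dl).
Qed.
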